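(* Let $\mathcal V$ be a variety of algebras. The free $\mathcal V$-algebra functor $F\colon \mathrm{Set}\to\mathcal V$ has a lift to a strong monoidal functor $\widehat F\colon (\mathrm{Set},\times,\{*\})\to(\mathcal V^{c},\odot,I)$, where $\mathcal V^{c}$ is the category of co-$\mathcal V$-algebra objects in $\mathcal V$ with its Tall–Wraith monoidal structure. (Here ''lift'' means that the composite of $\widehat F$ with the forgetful functor $\mathcal V^{c}\to\mathcal V$ is $F$.)
   Context: A variety of algebras $\mathcal V$ is the category of models in $\mathrm{Set}$ of a (finitary, single-sorted) Lawvere theory; $F$ is the left adjoint of the forgetful functor $|\cdot|\colon\mathcal V\to\mathrm{Set}$. For a category $\mathcal E$ with finite coproducts, a co-$\mathcal V$-algebra object in $\mathcal E$ is a model of the theory in $\mathcal E^{op}$, i.e. an object $X$ of $\mathcal E$ with co-operations $X\to\coprod_n X$; equivalently, an object $X$ with a lift of $\mathrm{Hom}_{\mathcal E}(X,-)\colon\mathcal E\to\mathrm{Set}$ to a functor $\mathcal E\to\mathcal V$. Morphisms are $\mathcal E$-morphisms compatible with the co-operations. $\mathcal V^{c}$ denotes the category of co-$\mathcal V$-algebra objects in $\mathcal V$. For $T\in\mathcal V^{c}$ and $V\in\mathcal V$, $\mathrm{Hom}_{\mathcal V}(T,V)$ denotes the resulting $\mathcal V$-algebra on the hom-set. The Tall–Wraith monoidal structure $(\mathcal V^{c},\odot,I)$ is the one corresponding to composition of representable functors $\mathcal V\to\mathcal V$: there are natural isomorphisms of $\mathcal V$-algebras $\mathrm{Hom}_{\mathcal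 V}(T_1\odot T_2,V)\cong\mathrm{Hom}_{\mathcal V}(T_1,\mathrm{Hom}_{\mathcal V}(T_2,V))$ and $\mathrm{Hom}_{\mathcal V}(I,V)\cong V$, and the coherence isomorphisms are those induced by composition of functors. *)

(* Defs.v *)
From mathcomp Require Import all_boot.
From mathcomp Require Import boolp.

Set Implicit Arguments.
Unset Strict Implicit.
Unset Printing Implicit Defensive.

Declare Scope cat_scope.
Delimit Scope cat_scope with cat.
Local Open Scope cat_scope.

Reserved Notation "g ∘ f" (at level 40, left associativity).

Record category := Category {
  obj :> Type;
  hom : obj -> obj -> Type;
  idm : forall A, hom A A;
  comp : forall A B C, hom B C -> hom A B -> hom A C;
  compIm : forall A B (f : hom A B), comp (idm B) f = f;
  compmI : forall A B (f : hom A B), comp f (idm A) = f;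
  compA : forall A B C D (h : hom C D) (g : hom B C) (f : hom A B),
    comp h (comp g f) = comp (comp h g) f }.

Arguments hom {c} _ _.
Arguments idm {c} _.
Arguments comp {c A B C} _ _.
Notation "g ∘ f" := (comp g f) : cat_scope.

Definition op (C : category) : category :=
  @Category C (fun A B => @hom C B A) (@idm C) (fun _ _ _ g f => f ∘ g)
    (fun _ _ f => compmI f) (fun _ _ f => compIm f)
    (fun _ _ _ _ h g f => esym (compA f g h)).

Definition SET : category :=
  @Category Type (fun A B => A -> B) (fun _ x => x) (fun _ _ _ g f x => g (f x))
    (fun _ _ _ => erefl) (fun _ _ _ => erefl) (fun _ _ _ _ _ _ _ => erefl).

Record iso (C : category) (A B : C) := Iso {
  fwd :> hom A B;
  bwd : hom B A;
  bwdK : bwd ∘ fwd = idm A;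
  fwdK : fwd ∘ bwd = idm B }.

Record functor (C D : category) := Functor {
  fobj :> C -> D;
  fmap : forall A B, hom A B -> hom (fobj A) (fobj B);
  fmap1 : forall A, fmap (idm A) = idm (fobj A);
  fmapM : forall A B E (g : hom B E) (f : hom A B),
    fmap (g ∘ f) = fmap g ∘ fmap f }.

Arguments fmap {C D} _ {A B} _.

Program Definition fcomp (C D E : category) (G : functor D E) (F : functor C D) :
  functor C E := @Functor C E (fun A => G (F A)) (fun _ _ f => fmap G (fmap F f)) _ _.
Next Obligation. by rewrite !fmap1. Qed.
Next Obligation. by rewrite !fmapM. Qed.

Record adjunction (C D : category) (F : functor C D) (G : functor D C) := Adjunction {
  transpose : forall X A, hom (F X) A -> hom X (G A);
  untranspose : forall X A, hom X (G A) -> hom (F X) A;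
  transposeK : forall X A, cancel (@transpose X A) (@untranspose X A);
  untransposeK : forall X A, cancel (@untranspose X A) (@transpose X A);
  transpose_natl : forall X Y A (x : hom X Y) (f : hom (F Y) A),
    transpose (f ∘ fmap F x) = transpose f ∘ x;
  transpose_natr : forall X A B (f : hom (F X) A) (a : hom A B),
    transpose (a ∘ f) = fmap G a ∘ transpose f }.

Definition is_product (C : category) (I : Type) (X : I -> C) (P : C)
    (p : forall i, hom P (X i)) :=
  forall (Y : C) (f : forall i, hom Y (X i)),
    exists! g : hom Y P, forall i, p i ∘ g = f i.

(* Only the universal property of the projections is required. In particular
   [lproj] at n = 1 need not be the identity; it is automatically invertible,
   and neither models nor their morphisms depend on the choice of projections. *)
Record lawvere_theory := LawvereTheory {
  lhom : nat -> nat -> Type;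
  lid : forall n, lhom n n;
  lcomp : forall m n k, lhom n k -> lhom m n -> lhom m k;
  lcompIm : forall m n (f : lhom m n), lcomp (lid n) f = f;
  lcompmI : forall m n (f : lhom m n), lcomp f (lid m) = f;
  lcompA : forall m n k l (h : lhom k l) (g : lhom n k) (f : lhom m n),
    lcomp h (lcomp g f) = lcomp (lcomp h g) f;
  lcat :> category := Category lcompIm lcompmI lcompA;
  lproj : forall n, 'I_n -> @hom lcat n 1;
  lprojP : forall n, is_product (X := fun _ : 'I_n => (1 : lcat)) (@lproj n) }.

Arguments lproj {_ n} _.

(* Preservation of the powers of the generic object 1 amounts to preservation
   of all finite products, and does not require chosen products in C. *)
Record model (L : lawvere_theory) (C : category) := Model {
  mfun :> functor L C;
  mfunP : forall n, is_product (fun i : 'I_n => fmap mfun (lproj i)) }.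

(* Natural transformations; [n : nat] is written instead of [n : L] so that the
   type of morphisms stays in the universe of small sets. *)
Record model_hom (L : lawvere_theory) (C : category) (M N : model L C) := ModelHom {
  component :> forall n : nat, hom (M n) (N n);
  naturality : forall (m n : nat) (w : @hom L m n),
    component n ∘ fmap M w = fmap N w ∘ component m }.

Lemma model_hom_eq (L : lawvere_theory) (C : category) (M N : model L C)
  (s t : model_hom M N) : (forall n, s n = t n) -> s = t.
Proof.
case: s t => [s sP] [t tP] /= st.
have e : s = t by exact: functional_extensionality_dep.
by case: _ / e in tP st *; congr ModelHom; exact: Prop_irrelevance.
Qed.

Program Definition model_id (L : lawvere_theory) (C : category) (M : model L C) :
  model_hom M M := @ModelHom L C M M (fun n => idm (M n)) _.
Next Obligation. by rewrite compIm compmI. Qed.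

Program Definition model_comp (L : lawvere_theory) (C : category) (M N P : model L C)
  (t : model_hom N P) (s : model_hom M N) : model_hom M P :=
  @ModelHom L C M P (fun n => t n ∘ s n) _.
Next Obligation. by rewrite -compA naturality compA naturality -compA. Qed.

Program Definition models (L : lawvere_theory) (C : category) : category :=
  @Category (model L C) (@model_hom L C) (@model_id L C) (@model_comp L C) _ _ _.
Next Obligation. by apply: model_hom_eq => n; exact: compIm. Qed.
Next Obligation. by apply: model_hom_eq => n; exact: compmI. Qed.
Next Obligation. by apply: model_hom_eq => n; exact: compA. Qed.

Definition variety (L : lawvere_theory) : category := models L SET.

Definition underlying (L : lawvere_theory) : functor (variety L) SET :=
  @Functor (variety L) SET (fun V => V 1) (fun _ _ f => f 1)
    (fun _ => erefl) (fun _ _ _ _ _ => erefl).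

(* The outer [op] makes a morphism S -> T a morphism from the object of S to
   that of T in E, compatible with the co-operations. *)
Definition comodels (L : lawvere_theory) (E : category) : category :=
  op (models L (op E)).

Definition coforget (L : lawvere_theory) (E : category) : functor (comodels L E) E :=
  @Functor (comodels L E) E (fun T : model L (op E) => T 1)
    (fun _ _ (f : model_hom _ _) => f 1)
    (fun _ => erefl) (fun _ _ _ _ _ => erefl).

Section HomAlgebra.
Variables (L : lawvere_theory) (E : category).
Implicit Types (T : comodels L E) (X : E).

(* Its n-th set is Hom(T_n, X), where T_n is the n-th copower of the object T_1
   underlying T. *)
Program Definition homalg_functor (T : model L (op E)) (X : E) : functor L SET :=
  @Functor L SET (fun n => @hom E (T n) X)
    (fun m n (w : hom m n) (f : @hom E (T m) X) => f ∘ (fmap T w : @hom E (T n) (T m)))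
    _ _.
Next Obligation. by apply: funext => g; rewrite fmap1 compmI. Qed.
Next Obligation. by apply: funext => h; rewrite fmapM /= compA. Qed.

Lemma homalg_subproof (T : model L (op E)) (X : E) n :
  is_product (fun i : 'I_n => fmap (homalg_functor T X) (lproj i)).
Proof.
move=> Y f.
have [g gP] : {g : Y -> @hom E (T n) X & forall y i,
    g y ∘ (fmap T (lproj i) : @hom E (T 1) (T n)) = f i y}.
  have ex y : {g : @hom E (T n) X |
      forall i, g ∘ (fmap T (lproj i) : @hom E (T 1) (T n)) = f i y}.
    by apply: cid; have [g [gP _]] := @mfunP L (op E) T n X (f ^~ y); exists g.
  by exists (fun y => sval (ex y)) => y; exact: (svalP (ex y)).
exists g; split=> [i|h hP]; first by apply: funext => y; exact: gP.
apply: funext => y; have [k [_ kU]] := @mfunP L (op E) T n X (f ^~ y).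
rewrite -(kU (g y) (gP y)); apply: kU => i.
by rewrite -(hP i).
Qed.

Definition homalg (T : comodels L E) (X : E) : variety L :=
  @Model L SET (homalg_functor T X) (@homalg_subproof T X).

Program Definition homalg_post T X Y (f : hom X Y) : hom (homalg T X) (homalg T Y) :=
  @ModelHom L SET (homalg T X) (homalg T Y) (fun _ g => f ∘ g) _.
Next Obligation. by apply: funext => g /=; rewrite compA. Qed.

Program Definition homalg_pre S T X (t : hom S T) : hom (homalg T X) (homalg S X) :=
  @ModelHom L SET (homalg T X) (homalg S X)
    (fun n g => g ∘ ((t : model_hom (T : model L (op E)) (S : model L (op E))) n
                       : @hom E ((S : model L (op E)) n) ((T : model L (op E)) n))) _.
Next Obligation.
apply: funext => g /=; rewrite -!compA; congr (_ ∘ _).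
exact: (@naturality _ (op E) _ _ t _ _ w).
Qed.

End HomAlgebra.

Arguments homalg_post {L E} T {X Y} f.
Arguments homalg_pre {L E S T} X t.

Record monoidal (C : category) := Monoidal {
  tensor : C -> C -> C;
  tensorm : forall A A' B B',
    hom A A' -> hom B B' -> hom (tensor A B) (tensor A' B');
  tensorm1 : forall A B, tensorm (idm A) (idm B) = idm (tensor A B);
  tensormM : forall A A' A'' B B' B'' (f' : hom A' A'') (f : hom A A')
      (g' : hom B' B'') (g : hom B B'),
    tensorm (f' ∘ f) (g' ∘ g) = tensorm f' g' ∘ tensorm f g;
  munit : C;
  massoc : forall A B D, iso (tensor (tensor A B) D) (tensor A (tensor B D));
  massoc_nat : forall A A' B B' D D' (f : hom A A') (g : hom B B') (h : hom D D'),
    massoc A' B' D' ∘ tensorm (tensorm f g) h =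
    tensorm f (tensorm g h) ∘ massoc A B D;
  mlunit : forall A, iso (tensor munit A) A;
  mlunit_nat : forall A A' (f : hom A A'),
    mlunit A' ∘ tensorm (idm munit) f = f ∘ mlunit A;
  mrunit : forall A, iso (tensor A munit) A;
  mrunit_nat : forall A A' (f : hom A A'),
    mrunit A' ∘ tensorm f (idm munit) = f ∘ mrunit A;
  pentagon : forall A B D E,
    massoc A B (tensor D E) ∘ massoc (tensor A B) D E =
    tensorm (idm A) (massoc B D E) ∘ massoc A (tensor B D) E
      ∘ tensorm (massoc A B D) (idm E);
  triangle : forall A B,
    tensorm (idm A) (mlunit B) ∘ massoc A munit B = tensorm (mrunit A) (idm B) }.

Arguments munit {C} _.
Arguments massoc {C} _ _ _ _.
Arguments mlunit {C} _ _.
Arguments mrunit {C} _ _.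

Program Definition set_cartesian : monoidal SET :=
  @Monoidal SET (fun A B => (A * B)%type)
    (fun _ _ _ _ f g x => (f x.1, g x.2)) _ _ unit
    (fun A B D => @Iso SET _ _ (fun x : A * B * D => (x.1.1, (x.1.2, x.2)))
                               (fun x => (x.1, x.2.1, x.2.2)) _ _) _
    (fun A => @Iso SET _ _ (fun x : unit * A => x.2) (fun a => (tt, a)) _ _) _
    (fun A => @Iso SET _ _ (fun x : A * unit => x.1) (fun a => (a, tt)) _ _) _ _ _.
Next Obligation. by apply: funext => -[]. Qed.
Next Obligation. by apply: funext => -[[]]. Qed.
Next Obligation. by apply: funext => -[? []]. Qed.
Next Obligation. by apply: funext => -[[]]. Qed.
Next Obligation. by apply: funext => -[? []]. Qed.

Record strong_monoidal (C D : category) (MC : monoidal C) (MD : monoidal D)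
    (F : functor C D) := StrongMonoidal {
  smunit : iso (munit MD) (F (munit MC));
  smtensor : forall A B, iso (tensor MD (F A) (F B)) (F (tensor MC A B));
  smtensor_nat : forall A A' B B' (f : hom A A') (g : hom B B'),
    smtensor A' B' ∘ tensorm MD (fmap F f) (fmap F g) =
    fmap F (tensorm MC f g) ∘ smtensor A B;
  smassoc : forall A B E,
    fmap F (massoc MC A B E) ∘ smtensor (tensor MC A B) E
      ∘ tensorm MD (smtensor A B) (idm (F E)) =
    smtensor A (tensor MC B E) ∘ tensorm MD (idm (F A)) (smtensor B E)
      ∘ massoc MD (F A) (F B) (F E);
  smlunit : forall A,
    fmap F (mlunit MC A) ∘ smtensor (munit MC) A ∘ tensorm MD smunit (idm (F A)) =
    mlunit MD (F A);
  smrunit : forall A,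
    fmap F (mrunit MC A) ∘ smtensor A (munit MC) ∘ tensorm MD (idm (F A)) smunit =
    mrunit MD (F A) }.

(* [M] is the monoidal structure for which T |-> Hom(T, -) carries [tensor M] to
   composition of functors V -> V, and [munit M] to the identity functor; the
   last three fields say that the coherence isomorphisms of [M] correspond to
   the (identity) associativity and unit constraints of functor composition. *)
Record tall_wraith (L : lawvere_theory) (M : monoidal (comodels L (variety L))) :=
  TallWraith {
  twcomp : forall T1 T2 V,
    iso (homalg (tensor M T1 T2) V) (homalg T1 (homalg T2 V));
  twcomp_nat : forall T1 T2 V W (f : hom V W),
    twcomp T1 T2 W ∘ homalg_post (tensor M T1 T2) f =
    homalg_post T1 (homalg_post T2 f) ∘ twcomp T1 T2 V;
  twcomp_natl : forall S1 T1 T2 V (s : hom S1 T1),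
    twcomp S1 T2 V ∘ homalg_pre V (tensorm M s (idm T2)) =
    homalg_pre (homalg T2 V) s ∘ twcomp T1 T2 V;
  twcomp_natr : forall T1 S2 T2 V (s : hom S2 T2),
    twcomp T1 S2 V ∘ homalg_pre V (tensorm M (idm T1) s) =
    homalg_post T1 (homalg_pre V s) ∘ twcomp T1 T2 V;
  twid : forall V, iso (homalg (munit M) V) V;
  twid_nat : forall V W (f : hom V W),
    twid W ∘ homalg_post (munit M) f = f ∘ twid V;
  twassoc : forall T1 T2 T3 V,
    twcomp T1 T2 (homalg T3 V) ∘ twcomp (tensor M T1 T2) T3 V
      ∘ homalg_pre V (massoc M T1 T2 T3) =
    homalg_post T1 (twcomp T2 T3 V) ∘ twcomp T1 (tensor M T2 T3) V;
  twlunit : forall T V,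
    twid (homalg T V) ∘ twcomp (munit M) T V ∘ homalg_pre V (mlunit M T) =
    idm (homalg T V);
  twrunit : forall T V,
    homalg_post T (twid V) ∘ twcomp T (munit M) V ∘ homalg_pre V (mrunit M T) =
    idm (homalg T V) }.

(* The remainder of the file shows that every variety has a Tall-Wraith monoidal
   structure: [tall_wraith_exists]. *)
Module TallWraithExistence.

Section Quotient.
Variables (X : Type) (step : X -> X -> Prop).

Inductive clos : X -> X -> Prop :=
| clos_refl x : clos x x
| clos_fwd x y z : step x y -> clos y z -> clos x z
| clos_bwd x y z : step y x -> clos y z -> clos x z.

Lemma clos_trans x y z : clos x y -> clos y z -> clos x z.
Proof.
by elim=> [//|a b c s _ IH|a b c s _ IH] /IH; [apply: clos_fwd|apply: clos_bwd].
Qed.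

Lemma clos_sym x y : clos x y -> clos y x.
Proof.
elim=> [a|a b c s _ IH|a b c s _ IH]; first exact: clos_refl.
  by apply: (clos_trans IH); apply: (clos_bwd s); apply: clos_refl.
by apply: (clos_trans IH); apply: (clos_fwd s); apply: clos_refl.
Qed.

Definition quot := {P : X -> Prop | exists x, P = clos x}.
Definition cls (x : X) : quot := exist _ (clos x) (ex_intro _ x erefl).

Lemma cls_clos x y : clos x y -> cls x = cls y.
Proof.
move=> xy; apply: eq_exist => /=; apply: funext => z; apply: propext.
by split; [apply: clos_trans (clos_sym xy)|apply: clos_trans xy].
Qed.

Lemma clos_cls x y : cls x = cls y -> clos x y.
Proof. by move=> /(congr1 sval) /= ->; apply: clos_refl. Qed.

Lemma cls_step x y : step x y -> cls x = cls y.
Proof. by move=> s; apply/cls_clos/(clos_fwd s)/clos_refl. Qed.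

Lemma cls_surj q : exists x, q = cls x.
Proof. by case: q => P [x e]; exists x; apply: eq_exist. Qed.

Definition qlift (Y : Type) (f : X -> Y) (q : quot) : Y :=
  f (sval (cid (cls_surj q))).

Lemma qliftE (Y : Type) (f : X -> Y) x :
  (forall x y, step x y -> f x = f y) -> qlift f (cls x) = f x.
Proof.
move=> fP; rewrite /qlift; case: cid => y /= /clos_cls.
by elim=> [//|a b c /fP -> _ ->|a b c /fP -> _ ->].
Qed.
End Quotient.

Lemma SET_product (I : Type) (X : I -> Type) (P : Type) (p : forall i, P -> X i) :
  (forall c : forall i, X i, exists q, forall i, p i q = c i) ->
  (forall q q', (forall i, p i q = p i q') -> q = q') ->
  @is_product SET I X P p.
Proof.
move=> ex un Y f.
have [g gP] : {g : Y -> P & forall y i, p i (g y) = f i y}.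
  have h y := cid (ex (fun i => f i y)).
  by exists (fun y => sval (h y)) => y; apply: (svalP (h y)).
exists g; split=> [i|h hP]; first by apply: funext => y; apply: gP.
by apply: funext => y; apply: un => i; rewrite gP -hP.
Qed.

Lemma SET_product_ex (I : Type) (X : I -> Type) (P : Type) (p : forall i, P -> X i) :
  @is_product SET I X P p -> forall c : forall i, X i, exists q, forall i, p i q = c i.
Proof.
move=> pP c; have [g [gP _]] := pP unit (fun i _ => c i).
by exists (g tt) => i; rewrite -[RHS](congr1 (@^~ tt) (gP i)).
Qed.

Lemma SET_product_un (I : Type) (X : I -> Type) (P : Type) (p : forall i, P -> X i) :
  @is_product SET I X P p -> forall q q', (forall i, p i q = p i q') -> q = q'.
Proof.
move=> pP q q' e; have [g [_ gU]] := pP unit (fun i _ => p i q).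
have e1 := gU (fun _ => q) (fun i => erefl).
have e2 : g = (fun _ => q') by apply: gU => i; apply: funext => y /=; rewrite e.
exact: (congr1 (fun f : unit -> P => f tt) (etrans (esym e1) e2)).
Qed.

Lemma prod_un (C : category) I (X : I -> C) P (p : forall i, hom P (X i)) :
  is_product p -> forall Y (g h : hom Y P), (forall i, p i ∘ g = p i ∘ h) -> g = h.
Proof.
move=> pP Y g h e; have [k [_ kU]] := pP Y (fun i => p i ∘ h).
by rewrite -(kU g) // -(kU h).
Qed.

Section Products.
Variables (K : lawvere_theory) (I : finType) (n : I -> nat).

Definition pobj : nat := #|{: {i : I & 'I_(n i)}}|.

Lemma prod_exists : exists p : forall i, @hom K pobj (n i),
  [/\ is_product (C := K) p &
   forall A : model K SET, is_product (C := SET) (fun i => fmap A (p i))].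
Proof.
have h i : exists p : @hom K pobj (n i),
    forall j, lproj j ∘ p = lproj (enum_rank (Tagged (fun i => 'I_(n i)) j)).
  have [p [pP _]] := @lprojP K (n i) pobj
    (fun j => lproj (enum_rank (Tagged (fun i => 'I_(n i)) j))).
  by exists p.
pose p := fun i => sval (cid (h i)).
have pP : forall i j, lproj j ∘ p i = lproj (enum_rank (Tagged (fun i => 'I_(n i)) j)).
  by move=> i j; exact: (svalP (cid (h i))).
exists p; split.
  move=> Y f.
  have [g [gP gU]] := @lprojP K pobj Y
    (fun s => lproj (tagged (enum_val s)) ∘ f (tag (enum_val s))).
  exists g; split=> [i|g' g'P].
    apply: (prod_un (@lprojP K (n i))) => j.
    by rewrite compA pP gP enum_rankK.
  apply: gU => s; rewrite -g'P compA pP.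
  have -> : Tagged (fun i => 'I_(n i)) (tagged (enum_val s)) = enum_val s.
    by case: (enum_val s).
  by rewrite enum_valK.
move=> A; apply: SET_product => [c|q q' e].
  have [a aP] := SET_product_ex (@mfunP K SET A pobj)
    (fun s => fmap A (lproj (tagged (enum_val s))) (c (tag (enum_val s)))).
  exists a => i; apply: (SET_product_un (@mfunP K SET A (n i))) => j.
  have := aP (enum_rank (Tagged (fun i => 'I_(n i)) j)).
  rewrite enum_rankK /= => <-; rewrite -pP.
  by rewrite fmapM.
apply: (SET_product_un (@mfunP K SET A pobj)) => s.
rewrite -[s]enum_valK; case: (enum_val s) => i j.
by rewrite -(pP i j) fmapM /= e.
Qed.
End Products.

(* The coend of A(n) x T_n, computed pointwise in SET. It is again a model because
   A preserves finite products, and it represents B |-> Hom(A, Hom(T, B)). *)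
Section Coend.
Variables (K L : lawvere_theory) (A : model K SET) (T : model K (op (variety L))).

Definition Tm (m n : nat) (w : @hom K m n) : model_hom (T n : model L SET) (T m) :=
  fmap T w.

Lemma Tm1 n k (t : (T n : model L SET) k) : Tm (idm (n : K)) k t = t.
Proof. by rewrite /Tm fmap1. Qed.

Lemma TmM m n p (v : @hom K n p) (w : @hom K m n) k (t : (T p : model L SET) k) :
  Tm (v ∘ w) k t = Tm w k (Tm v k t).
Proof. by rewrite /Tm fmapM. Qed.

Lemma TmN m n (w : @hom K m n) k l (v : @hom L k l) (t : (T n : model L SET) k) :
  Tm w l (fmap (T n : model L SET) v t) = fmap (T m : model L SET) v (Tm w k t).
Proof. exact: (congr1 (@^~ t) (naturality (Tm w) v)). Qed.

Record pre (k : nat) := Pre { p_n : nat; p_a : A p_n; p_t : (T p_n : model L SET) k }.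

Definition pstep k (x y : pre k) := exists w : @hom K (p_n y) (p_n x),
  p_a x = fmap A w (p_a y) /\ p_t y = Tm w k (p_t x).

Definition Q k := quot (@pstep k).
Definition qc k n (a : A n) (t : (T n : model L SET) k) : Q k := cls (@pstep k) (Pre a t).

Lemma qcE k m n (w : @hom K m n) (a : A m) (t : (T n : model L SET) k) :
  qc (fmap A w a) t = qc a (Tm w k t).
Proof. by apply: cls_step; exists w. Qed.

Lemma qc_surj k (q : Q k) : exists n (a : A n) (t : (T n : model L SET) k), q = qc a t.
Proof. by have [[n a t] ->] := cls_surj q; exists n, a, t. Qed.

Definition Qlift k Y (f : forall n, A n -> (T n : model L SET) k -> Y) : Q k -> Y :=
  qlift (fun x => f (p_n x) (p_a x) (p_t x)).

Lemma QliftE k Y (f : forall n, A n -> (T n : model L SET) k -> Y) n a t :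
  (forall m n (w : @hom K m n) a t, f n (fmap A w a) t = f m a (Tm w k t)) ->
  Qlift f (qc a t) = f n a t.
Proof.
move=> fP; rewrite /Qlift qliftE // => -[n1 a1 t1] [n2 a2 t2] [w /= [-> ->]].
exact: fP.
Qed.

Definition Qmap k l (v : @hom L k l) : Q k -> Q l :=
  Qlift (fun n a t => qc a (fmap (T n : model L SET) v t)).

Lemma QmapE k l (v : @hom L k l) n (a : A n) t :
  Qmap v (qc a t) = qc a (fmap (T n : model L SET) v t).
Proof. by rewrite /Qmap QliftE // => m p w b u; rewrite qcE TmN. Qed.

Program Definition Qfun : functor L SET := @Functor L SET Q Qmap _ _.
Next Obligation.
by apply: funext => q; have [n [a [t ->]]] := qc_surj q; rewrite QmapE fmap1.
Qed.
Next Obligation.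
apply: funext => q; have [n [a [t ->]]] := qc_surj q.
rewrite /= !QmapE; apply: (congr1 (qc a)).
exact: (congr1 (@^~ t) (@fmapM L SET (T n : model L SET) _ _ _ g f)).
Qed.

Definition comb_spec k (x : 'I_k -> pre 1) (c : pre k) :=
  exists p : forall i, @hom K (p_n c) (p_n (x i)),
  [/\ is_product (C := K) p,
      is_product (C := SET) (fun i => fmap A (p i)),
      forall i, fmap A (p i) (p_a c) = p_a (x i) &
      forall i, fmap (T (p_n c) : model L SET) (lproj i) (p_t c) = Tm (p i) 1 (p_t (x i))].

Lemma comb_ex k (x : 'I_k -> pre 1) : exists c, comb_spec x c.
Proof.
have [p [pP /(_ A) Ap]] := prod_exists K (fun i => p_n (x i)).
have [a aP] := SET_product_ex Ap (fun i => p_a (x i)).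
set N := pobj _ in p pP Ap a aP.
have [t tP] := SET_product_ex (@mfunP L SET (T N : model L SET) k)
  (fun i => Tm (p i) 1 (p_t (x i))).
by exists (Pre a t), p.
Qed.

Lemma comb_step k (x y : 'I_k -> pre 1) c d : comb_spec x c -> comb_spec y d ->
  (forall i, pstep (x i) (y i)) -> cls (@pstep k) c = cls (@pstep k) d.
Proof.
move=> [p [pP Ap ap tp]] [p' [_ _ ap' tp']] st.
pose w i := sval (cid (st i)).
have wP i : p_a (x i) = fmap A (w i) (p_a (y i)) /\ p_t (y i) = Tm (w i) 1 (p_t (x i)).
  exact: (svalP (cid (st i))).
have [u [uP _]] := pP _ (fun i => w i ∘ p' i).
apply: cls_step; exists u; split.
  apply: (SET_product_un Ap) => i.
  rewrite ap (wP i).1 -ap'.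
  by rewrite -[RHS]/((fmap A (p i) ∘ fmap A u) _) -fmapM uP fmapM.
apply: (SET_product_un (@mfunP L SET (T (p_n d) : model L SET) k)) => i.
by rewrite tp' (wP i).2 -TmM -uP TmM -tp TmN.
Qed.

Lemma pstep_refl k (x : pre k) : pstep x x.
Proof. by exists (idm (p_n x : K)); rewrite fmap1 Tm1. Qed.

Lemma comb_clos1 k (x y : 'I_k -> pre 1) (j : 'I_k) c d :
  comb_spec x c -> comb_spec y d ->
  (forall i, i != j -> x i = y i) -> clos (@pstep 1) (x j) (y j) ->
  cls (@pstep k) c = cls (@pstep k) d.
Proof.
move=> xc yd xy cl; move e1 : (x j) cl => a cl; move e2 : (y j) cl => b cl.
elim: cl x c e1 xc e2 xy => {a b} [a|a b z s _ IH|a b z s _ IH] x c e1 xc e2 xy.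
- apply: (comb_step xc yd) => i; have [->|ne] := eqVneq i j.
    by rewrite e1 e2; exact: pstep_refl.
  by rewrite xy //; exact: pstep_refl.
- pose x' i := if i == j then b else x i.
  have [c' xc'] := comb_ex x'.
  rewrite -(IH x' c') // ?/x' ?eqxx //; last by move=> i ne; rewrite (negPf ne) xy.
  apply: (comb_step xc xc') => i; rewrite /x'; have [->|ne] := eqVneq i j.
    by rewrite e1.
  exact: pstep_refl.
- pose x' i := if i == j then b else x i.
  have [c' xc'] := comb_ex x'.
  rewrite -(IH x' c') // ?/x' ?eqxx //; last by move=> i ne; rewrite (negPf ne) xy.
  symmetry; apply: (comb_step xc' xc) => i; rewrite /x'; have [->|ne] := eqVneq i j.
    by rewrite e1.
  exact: pstep_refl.
Qed.

Lemma comb_clos k (x y : 'I_k -> pre 1) c d : comb_spec x c -> comb_spec y d ->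
  (forall i, clos (@pstep 1) (x i) (y i)) -> cls (@pstep k) c = cls (@pstep k) d.
Proof.
move=> xc yd xy.
pose z m i := if (i : 'I_k) < m then y i else x i.
have H m : m <= k -> forall e, comb_spec (z m) e -> cls (@pstep k) c = cls (@pstep k) e.
  elim: m => [_ e ze|m IH mk e ze].
    by apply: (comb_step xc ze) => i; rewrite /z /=; exact: pstep_refl.
  have [e' ze'] := comb_ex (z m).
  rewrite (IH (ltnW mk) e' ze').
  apply: (comb_clos1 (j := Ordinal mk) ze' ze).
    move=> i ne; rewrite /z [i < m.+1]ltnS [i <= m]leq_eqVlt.
    have -> //: (i == m :> nat) = false.
    by apply/negbTE; apply: contraNneq ne => im; apply/eqP/val_inj.
  by rewrite /z /= ltnn leqnn.
apply: (H k (leqnn k)).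
by have -> : z k = y by apply: funext => i; rewrite /z ltn_ord.
Qed.

Lemma comb_diag k n (a : A n) (t : (T n : model L SET) k) c :
  comb_spec (fun i : 'I_k => Pre a (fmap (T n : model L SET) (lproj i) t)) c ->
  cls (@pstep k) c = qc a t.
Proof.
move=> [p [pP Ap ap tp]].
have [d [dP _]] := pP n (fun i => idm (n : K)).
apply: cls_step; exists d; split=> /=.
  apply: (SET_product_un Ap) => i; rewrite ap /=.
  by rewrite -[RHS]/((fmap A (p i) ∘ fmap A d) _) -fmapM dP fmap1.
apply: (SET_product_un (@mfunP L SET (T n : model L SET) k)) => i.
by rewrite -TmN tp -TmM dP Tm1.
Qed.

Lemma Q_product k : is_product (C := SET) (fun i : 'I_k => fmap Qfun (lproj i)).
Proof.
apply: SET_product => [c|q q' e].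
  have cx i := cid (cls_surj (c i)).
  pose x i := sval (cx i).
  have xE i : c i = cls (@pstep 1) (x i) by exact: (svalP (cx i)).
  have [[N a t] [p [_ _ ap tp]]] := comb_ex x.
  exists (qc a t) => i; rewrite /= QmapE.
  have /= tpi := tp i; have /= api := ap i; rewrite xE tpi -qcE api.
  by case: (x i).
have [n [a [t qE]]] := qc_surj q; have [m [b [u q'E]]] := qc_surj q'.
have [c cP] := comb_ex (fun i : 'I_k => Pre a (fmap (T n : model L SET) (lproj i) t)).
have [d dP] := comb_ex (fun i : 'I_k => Pre b (fmap (T m : model L SET) (lproj i) u)).
rewrite qE q'E -(comb_diag cP) -(comb_diag dP).
apply: (comb_clos cP dP) => i; apply: clos_cls.
by have := e i; rewrite qE q'E /= !QmapE.
Qed.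

Definition coend : variety L := @Model L SET Qfun Q_product.

Program Definition ucoend : @hom (variety K) A (homalg (T : comodels K (variety L)) coend) :=
  @ModelHom K SET A (homalg (T : comodels K (variety L)) coend)
    (fun n a => @ModelHom L SET (T n) coend (fun k t => qc a t) _) _.
Next Obligation.
by apply: funext => t; rewrite /= QmapE.
Qed.
Next Obligation.
apply: funext => a; apply: model_hom_eq => k; apply: funext => t /=.
by rewrite qcE.
Qed.

Lemma coend_univ (B : variety L) (f : @hom (variety K) A (homalg (T : comodels K (variety L)) B)) :
  exists! g : hom coend B, homalg_post (T : comodels K (variety L)) g ∘ ucoend = f.
Proof.
have fN m n (w : @hom K m n) (a : A m) k (t : (T n : model L SET) k) :
    (f n (fmap A w a) : model_hom _ _) k t = (f m a : model_hom _ _) k (Tm w k t).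
  by have /(congr1 (fun h : model_hom (T n : model L SET) B => h k t)) :=
    congr1 (@^~ a) (naturality f w).
pose g k := Qlift (fun n a t => (f n a : model_hom (T n : model L SET) B) k t).
have gE k n a t : g k (qc a t) = (f n a : model_hom (T n : model L SET) B) k t.
  by rewrite /g QliftE // => m p w b u; rewrite fN.
have gN (m n : nat) (w : @hom L m n) :
    (g n : @hom SET _ _) ∘ fmap Qfun w = fmap (B : model L SET) w ∘ (g m : @hom SET _ _).
  apply: funext => q; have [p [a [t ->]]] := qc_surj q; rewrite /= QmapE !gE.
  exact: (congr1 (@^~ t) (naturality (f p a) w)).
exists (@ModelHom L SET coend B g gN : hom coend B); split.
  apply: model_hom_eq => n; apply: funext => a; apply: model_hom_eq => k.
  by apply: funext => t /=; rewrite gE.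
move=> h hE; apply: model_hom_eq => k; apply: funext => q.
have [n [a [t ->]]] := qc_surj q; rewrite /= gE.
by rewrite -hE.
Qed.
End Coend.

(* Monoidal structure on M transported along a fully faithful M^op -> [V, V]. *)
Section Abstract.
Variables (M V : category) (R : M -> V -> V).
Variable post : forall T X Y, hom X Y -> hom (R T X) (R T Y).
Variable pre : forall S T X, hom S T -> hom (R T X) (R S X).
Hypothesis post1 : forall T X, post T (idm X) = idm (R T X).
Hypothesis postM : forall T X Y Z (g : hom Y Z) (f : hom X Y),
  post T (g ∘ f) = post T g ∘ post T f.
Hypothesis pre1 : forall T X, pre X (idm T) = idm (R T X).
Hypothesis preM : forall S T U X (t : hom T U) (s : hom S T),
  pre X (t ∘ s) = pre X s ∘ pre X t.
Hypothesis prepost : forall S T X Y (s : hom S T) (f : hom X Y),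
  pre Y s ∘ post T f = post S f ∘ pre X s.
Hypothesis pre_inj : forall S T (f g : hom S T), (forall X, pre X f = pre X g) -> f = g.
Hypothesis yo : forall S T (th : forall X, hom (R T X) (R S X)),
  (forall X Y (f : hom X Y), th Y ∘ post T f = post S f ∘ th X) ->
  exists f, forall X, pre X f = th X.
Variables (ten : M -> M -> M) (I : M).
Variable b : forall T1 T2 X, iso (R (ten T1 T2) X) (R T1 (R T2 X)).
Variable e : forall X, iso (R I X) X.
Hypothesis b_nat : forall T1 T2 X Y (f : hom X Y),
  b T1 T2 Y ∘ post (ten T1 T2) f = post T1 (post T2 f) ∘ b T1 T2 X.
Hypothesis e_nat : forall X Y (f : hom X Y), e Y ∘ post I f = f ∘ e X.

Lemma can_l (C : category) (A B : C) (i : iso A B) X (f g : hom X A) :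
  i ∘ f = i ∘ g -> f = g.
Proof. by move=> /(congr1 (comp (bwd i))); rewrite !compA bwdK !compIm. Qed.

Definition postiso T X Y (i : iso X Y) : iso (R T X) (R T Y).
Proof.
exists (post T i) (post T (bwd i)).
  by rewrite -postM bwdK post1.
by rewrite -postM fwdK post1.
Defined.

Definition isocomp (C : category) (A B D : C) (j : iso B D) (i : iso A B) : iso A D.
Proof.
exists (j ∘ i) (bwd i ∘ bwd j).
  by rewrite -compA [X in _ ∘ X]compA bwdK compIm bwdK.
by rewrite -compA [X in _ ∘ X]compA fwdK compIm fwdK.
Defined.

Definition isoinv (C : category) (A B : C) (i : iso A B) : iso B A :=
  Iso (fwdK i) (bwdK i).

Lemma bwd_nat (A B : forall X : V, V) (i : forall X, iso (A X) (B X)) 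
  (pa : forall X Y, hom X Y -> hom (A X) (A Y)) (pb : forall X Y, hom X Y -> hom (B X) (B Y)) :
  (forall X Y f, i Y ∘ pa X Y f = pb X Y f ∘ i X) ->
  forall X Y f, bwd (i Y) ∘ pb X Y f = pa X Y f ∘ bwd (i X).
Proof.
move=> H X Y f; apply: (can_l (i := i Y)).
by rewrite !compA fwdK compIm H -compA fwdK compmI.
Qed.

Lemma yo_iso S T (th : forall X, iso (R T X) (R S X)) :
  (forall X Y (f : hom X Y), th Y ∘ post T f = post S f ∘ th X) ->
  exists i : iso S T, forall X, pre X i = th X.
Proof.
move=> H; have [f fE] := yo H.
have [g gE] := yo (bwd_nat H).
have fg : f ∘ g = idm T by apply: pre_inj => X; rewrite preM fE gE bwdK pre1.
have gf : g ∘ f = idm S by apply: pre_inj => X; rewrite preM fE gE fwdK pre1.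
by exists (Iso gf fg).
Qed.

Lemma yo_iso2 S T (G : V -> V) (pg : forall X Y, hom X Y -> hom (G X) (G Y))
  (l : forall X, iso (R S X) (G X)) (r : forall X, iso (R T X) (G X)) :
  (forall X Y (f : hom X Y), l Y ∘ post S f = pg X Y f ∘ l X) ->
  (forall X Y (f : hom X Y), r Y ∘ post T f = pg X Y f ∘ r X) ->
  exists i : iso S T, forall X, l X ∘ pre X i = r X.
Proof.
move=> lN rN; have [|i iE] := @yo_iso S T (fun X => isocomp (isoinv (l X)) (r X)).
  move=> X Y f /=; apply: (can_l (i := l Y)).
  by rewrite !compA lN fwdK compIm rN -!compA (compA (l X)) fwdK compIm.
by exists i => X; rewrite iE /= compA fwdK compIm.
Qed.

Lemma ten_ex S1 T1 S2 T2 (f : hom S1 T1) (g : hom S2 T2) :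
  exists h : hom (ten S1 S2) (ten T1 T2),
  forall X, b S1 S2 X ∘ pre X h = pre (R S2 X) f ∘ post T1 (pre X g) ∘ b T1 T2 X.
Proof.
have [|h hE] := @yo (ten S1 S2) (ten T1 T2)
   (fun X => bwd (b S1 S2 X) ∘ (pre (R S2 X) f ∘ post T1 (pre X g) ∘ b T1 T2 X)).
  move=> X Y x; apply: (can_l (i := b S1 S2 Y)).
  rewrite !compA b_nat !fwdK !compIm -!compA b_nat.
  rewrite [in RHS](compA (b _ _ _)) fwdK compIm.
  rewrite !compA -prepost -!compA; congr (_ ∘ _).
  by rewrite !compA -!postM prepost.
by exists h => X; rewrite hE compA fwdK compIm.
Qed.

Definition tenm S1 T1 S2 T2 (f : hom S1 T1) (g : hom S2 T2) := sval (cid (ten_ex f g)).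
Lemma tenmE S1 T1 S2 T2 (f : hom S1 T1) (g : hom S2 T2) X :
  b S1 S2 X ∘ pre X (tenm f g) = pre (R S2 X) f ∘ post T1 (pre X g) ∘ b T1 T2 X.
Proof. exact: (svalP (cid (ten_ex f g))). Qed.

Lemma a_ex T1 T2 T3 : exists i : iso (ten (ten T1 T2) T3) (ten T1 (ten T2 T3)),
  forall X, b T1 T2 (R T3 X) ∘ b (ten T1 T2) T3 X ∘ pre X i =
            post T1 (b T2 T3 X) ∘ b T1 (ten T2 T3) X.
Proof.
pose l X := isocomp (b T1 T2 (R T3 X)) (b (ten T1 T2) T3 X).
pose r X := isocomp (postiso T1 (b T2 T3 X)) (b T1 (ten T2 T3) X).
have lN X Y (f : hom X Y) :
  l Y ∘ post _ f = post T1 (post T2 (post T3 f)) ∘ l X.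
  by rewrite /l /= -compA b_nat compA b_nat compA.
have rN X Y (f : hom X Y) :
  r Y ∘ post _ f = post T1 (post T2 (post T3 f)) ∘ r X.
  by rewrite /r /= -compA b_nat compA -postM b_nat postM compA.
exact: (yo_iso2 (l := l) (r := r) lN rN).
Qed.

Definition al T1 T2 T3 := sval (cid (a_ex T1 T2 T3)).
Lemma alE T1 T2 T3 X : b T1 T2 (R T3 X) ∘ b (ten T1 T2) T3 X ∘ pre X (al T1 T2 T3) =
            post T1 (b T2 T3 X) ∘ b T1 (ten T2 T3) X.
Proof. exact: (svalP (cid (a_ex T1 T2 T3))). Qed.

Lemma l_ex T : exists i : iso (ten I T) T,
  forall X, e (R T X) ∘ b I T X ∘ pre X i = idm (R T X).
Proof.
pose l X := isocomp (e (R T X)) (b I T X).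
have lN X Y (f : hom X Y) : l Y ∘ post _ f = post T f ∘ l X.
  by rewrite /l /= -compA b_nat compA e_nat compA.
have [|i iE] := @yo_iso (ten I T) T (fun X => isoinv (l X)).
  by move=> X Y f /=; apply: (bwd_nat lN).
by exists i => X; rewrite iE; exact: (fwdK (l X)).
Qed.
Definition lu T := sval (cid (l_ex T)).
Lemma luE T X : e (R T X) ∘ b I T X ∘ pre X (lu T) = idm (R T X).
Proof. exact: (svalP (cid (l_ex T))). Qed.

Lemma r_ex T : exists i : iso (ten T I) T,
  forall X, post T (e X) ∘ b T I X ∘ pre X i = idm (R T X).
Proof.
pose l X := isocomp (postiso T (e X)) (b T I X).
have lN X Y (f : hom X Y) : l Y ∘ post _ f = post T f ∘ l X.
  by rewrite /l /= -compA b_nat compA -postM e_nat postM compA.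
have [|i iE] := @yo_iso (ten T I) T (fun X => isoinv (l X)).
  by move=> X Y f /=; apply: (bwd_nat lN).
by exists i => X; rewrite iE; exact: (fwdK (l X)).
Qed.
Definition ru T := sval (cid (r_ex T)).
Lemma ruE T X : post T (e X) ∘ b T I X ∘ pre X (ru T) = idm (R T X).
Proof. exact: (svalP (cid (r_ex T))). Qed.

Lemma tenmE' S1 T1 S2 T2 (f : hom S1 T1) (g : hom S2 T2) X Y (x : hom Y _) :
  b S1 S2 X ∘ (pre X (tenm f g) ∘ x) = pre (R S2 X) f ∘ (post T1 (pre X g) ∘ (b T1 T2 X ∘ x)).
Proof. by rewrite !compA tenmE. Qed.
Lemma alE' T1 T2 T3 X Y (x : hom Y _) :
  b T1 T2 (R T3 X) ∘ (b (ten T1 T2) T3 X ∘ (pre X (al T1 T2 T3) ∘ x)) =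
            post T1 (b T2 T3 X) ∘ (b T1 (ten T2 T3) X ∘ x).
Proof. by rewrite !compA alE. Qed.
Lemma alE0 T1 T2 T3 X :
  b T1 T2 (R T3 X) ∘ (b (ten T1 T2) T3 X ∘ pre X (al T1 T2 T3)) =
            post T1 (b T2 T3 X) ∘ b T1 (ten T2 T3) X.
Proof. by rewrite !compA alE. Qed.
Lemma tenmE0 S1 T1 S2 T2 (f : hom S1 T1) (g : hom S2 T2) X :
  b S1 S2 X ∘ pre X (tenm f g) = pre (R S2 X) f ∘ (post T1 (pre X g) ∘ b T1 T2 X).
Proof. by rewrite compA tenmE. Qed.
Lemma b_nat' T1 T2 X Y (f : hom X Y) Z (x : hom Z _) :
  b T1 T2 Y ∘ (post (ten T1 T2) f ∘ x) = post T1 (post T2 f) ∘ (b T1 T2 X ∘ x).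
Proof. by rewrite !compA b_nat. Qed.
Lemma e_nat' X Y (f : hom X Y) Z (x : hom Z _) : e Y ∘ (post I f ∘ x) = f ∘ (e X ∘ x).
Proof. by rewrite !compA e_nat. Qed.
Lemma prepost' S T X Y (s : hom S T) (f : hom X Y) Z (x : hom Z _) :
  pre Y s ∘ (post T f ∘ x) = post S f ∘ (pre X s ∘ x).
Proof. by rewrite !compA prepost. Qed.
Lemma luE0 T X : e (R T X) ∘ (b I T X ∘ pre X (lu T)) = idm (R T X).
Proof. by rewrite compA luE. Qed.
Lemma luE' T X Y (x : hom Y _) : e (R T X) ∘ (b I T X ∘ (pre X (lu T) ∘ x)) = x.
Proof. by rewrite !compA luE compIm. Qed.
Lemma ruE0 T X : post T (e X) ∘ (b T I X ∘ pre X (ru T)) = idm (R T X).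
Proof. by rewrite compA ruE. Qed.
Lemma ruE' T X Y (x : hom Y _) : post T (e X) ∘ (b T I X ∘ (pre X (ru T) ∘ x)) = x.
Proof. by rewrite !compA ruE compIm. Qed.

Lemma tenm1 T1 T2 : tenm (idm T1) (idm T2) = idm (ten T1 T2).
Proof.
by apply: pre_inj => X; apply: (can_l (i := b _ _ _)); rewrite tenmE !pre1 post1 compmI !compIm compmI.
Qed.

Lemma tenmM T1 T1' T1'' T2 T2' T2'' (f' : hom T1' T1'') (f : hom T1 T1')
   (g' : hom T2' T2'') (g : hom T2 T2') : tenm (f' ∘ f) (g' ∘ g) = tenm f' g' ∘ tenm f g.
Proof.
apply: pre_inj => X; apply: (can_l (i := b _ _ _)).
by rewrite preM tenmE' !tenmE0 !preM postM -!compA -prepost'.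
Qed.

Lemma al_nat T1 T1' T2 T2' T3 T3' (f : hom T1 T1') (g : hom T2 T2') (h : hom T3 T3') :
  al T1' T2' T3' ∘ tenm (tenm f g) h = tenm f (tenm g h) ∘ al T1 T2 T3.
Proof.
apply: pre_inj => X; rewrite !preM.
apply: (can_l (i := b _ _ _)); apply: (can_l (i := b _ _ _)).
rewrite alE' tenmE' tenmE' b_nat' alE0 tenmE0.
rewrite -!prepost'; congr (_ ∘ _).
rewrite !compA -!postM; congr (post _ _ ∘ _).
by rewrite tenmE -!compA.
Qed.

Lemma lu_nat T T' (f : hom T T') : lu T' ∘ tenm (idm I) f = f ∘ lu T.
Proof.
apply: pre_inj => X; rewrite !preM.
apply: (can_l (i := b _ _ _)); apply: (can_l (i := e _)).
by rewrite luE' tenmE' pre1 compIm e_nat' luE0 compmI.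
Qed.

Lemma ru_nat T T' (f : hom T T') : ru T' ∘ tenm f (idm I) = f ∘ ru T.
Proof.
apply: pre_inj => X; rewrite !preM.
apply: (can_l (i := b _ _ _)); apply: (can_l (i := postiso T (e _))) => /=.
by rewrite ruE' tenmE' pre1 post1 compIm -prepost' ruE0 compmI.
Qed.

Lemma pent A B D E :
    al A B (ten D E) ∘ al (ten A B) D E =
    tenm (idm A) (al B D E) ∘ al A (ten B D) E ∘ tenm (al A B D) (idm E).
Proof.
apply: pre_inj => X; rewrite !preM.
apply: (can_l (i := b _ _ _)); apply: (can_l (i := b _ _ _)); apply: (can_l (i := b _ _ _)).
rewrite alE' b_nat' alE0 tenmE' pre1 post1 compIm alE' alE' tenmE0 pre1 compIm.
rewrite !compA -!postM; congr (post _ _ ∘ _).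
by rewrite -!compA alE0.
Qed.

Lemma tri A B : tenm (idm A) (lu B) ∘ al A I B = tenm (ru A) (idm B).
Proof.
apply: pre_inj => X; rewrite !preM.
apply: (can_l (i := b _ _ _)); apply: (can_l (i := b _ _ _)).
apply: (can_l (i := postiso _ (e _))) => /=.
rewrite alE' !tenmE0 pre1 compIm pre1 post1 compIm ruE'.
by rewrite !compA -!postM luE post1 compIm.
Qed.

Definition mon : monoidal M :=
  Monoidal tenm1 tenmM al_nat lu_nat ru_nat pent tri.
End Abstract.

Section TW.
Variable L : lawvere_theory.
Local Notation V := (variety L).
Local Notation M := (comodels L V).
Implicit Types (S T : M) (X Y A B : V).

Definition co (T : M) (n : nat) : V := (T : model L (op V)) n.
Definition cm S T (t : hom S T) (n : nat) : hom (co S n) (co T n) :=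
  (t : model_hom (T : model L (op V)) (S : model L (op V))) n.
Definition cw T (m n : nat) (w : @hom L m n) : hom (co T n) (co T m) :=
  fmap (T : model L (op V)) w.

Lemma cmN S T (t : hom S T) m n (w : @hom L m n) : cw T w ∘ cm t n = cm t m ∘ cw S w.
Proof. exact: (@naturality _ (op V) _ _ t _ _ w). Qed.

Lemma hpost1 T X : homalg_post T (idm X) = idm (homalg T X).
Proof. by apply: model_hom_eq => n; apply: funext => f; exact: compIm. Qed.
Lemma hpostM T X Y Z (g : hom Y Z) (f : hom X Y) :
  homalg_post T (g ∘ f) = homalg_post T g ∘ homalg_post T f.
Proof. by apply: model_hom_eq => n; apply: funext => h; exact: (esym (@compA V _ _ _ _ g f h)). Qed.
Lemma hpre1 T X : homalg_pre X (idm T) = idm (homalg T X).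
Proof. by apply: model_hom_eq => n; apply: funext => f; exact: (@compmI V). Qed.
Lemma hpreM S T U X (t : hom T U) (s : hom S T) :
  homalg_pre X (t ∘ s) = homalg_pre X s ∘ homalg_pre X t.
Proof.
apply: model_hom_eq => n; apply: funext => h.
exact: (@compA V _ _ _ _ h (cm t n) (cm s n)).
Qed.
Lemma hprepost S T X Y (s : hom S T) (f : hom X Y) :
  homalg_pre Y s ∘ homalg_post T f = homalg_post S f ∘ homalg_pre X s.
Proof.
apply: model_hom_eq => n; apply: funext => h.
exact: (esym (@compA V _ _ _ _ f h (cm s n))).
Qed.
Lemma hpre_inj S T (f g : hom S T) :
  (forall X, homalg_pre X f = homalg_pre X g) -> f = g.
Proof.
move=> e; apply: (@model_hom_eq L (op V)) => n.
have := congr1 (fun h : model_hom (homalg T (co T n)) (homalg S (co T n)) => h n (idm (co T n))) (e (co T n)).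
by move=> e'; rewrite -[LHS](@compIm V) -[RHS](@compIm V); exact: e'.
Qed.

Lemma hyo S T (th : forall X, hom (homalg T X) (homalg S X)) :
  (forall X Y (f : hom X Y), th Y ∘ homalg_post T f = homalg_post S f ∘ th X) ->
  exists f, forall X, homalg_pre X f = th X.
Proof.
move=> H.
have HE X Y (f : hom X Y) n (g : hom (co T n) X) :
    (th Y n (f ∘ g) : hom (co S n) Y) = f ∘ (th X n g : hom (co S n) X).
  exact: (congr1 (fun h : model_hom (homalg T X) (homalg S Y) => h n g) (H X Y f)).
pose c n : hom (co S n) (co T n) := th (co T n) n (idm (co T n)).
have cN (m n : nat) (w : @hom L m n) : cw T w ∘ c n = c m ∘ cw S w.
  rewrite /c -HE compmI.
  have := congr1 (@^~ (idm (co T m))) (naturality (th (co T m)) w).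
  rewrite /= => <-.
  apply: (congr1 (th (co T m) n)); exact: (esym (@compIm V _ _ (cw T w))).
exists (@ModelHom L (op V) (T : model L (op V)) (S : model L (op V)) c cN).
move=> X; apply: model_hom_eq => n; apply: funext => g.
by rewrite -[RHS]/(th X n g : hom (co S n) X) -[g in RHS](@compmI V) HE.
Qed.

Definition coendV A T : V := @coend L L A (T : model L (op V)).
Definition uV A T : hom A (homalg T (coendV A T)) := @ucoend L L A (T : model L (op V)).
Definition ext A T B (f : hom A (homalg T B)) : hom (coendV A T) B :=
  sval (cid (coend_univ (f : @hom V A (homalg (T : comodels L V) B)))).
Lemma extP A T B (f : hom A (homalg T B)) : homalg_post T (ext f) ∘ uV A T = f.
Proof. by rewrite /ext; case: cid => g [/= gP _]. Qed.
Lemma ext_un A T B (g h : hom (coendV A T) B) :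
  homalg_post T g ∘ uV A T = homalg_post T h ∘ uV A T -> g = h.
Proof.
move=> e; have [k [_ kU]] := coend_univ (homalg_post T g ∘ uV A T).
by rewrite -(kU g) // -(kU h).
Qed.

Section Tensor.
Variables T1 T2 : M.

Definition tw (m n : nat) (w : @hom L m n) :
    hom (coendV (co T1 n) T2) (coendV (co T1 m) T2) :=
  ext (uV (co T1 m) T2 ∘ cw T1 w).

Program Definition tfun : functor L (op V) :=
  @Functor L (op V) (fun n => coendV (co T1 n) T2) tw _ _.
Next Obligation.
apply: ext_un; rewrite extP hpost1 compIm.
by rewrite [cw T1 _](fmap1 (T1 : model L (op V))) (@compmI V).
Qed.
Next Obligation.
apply: ext_un; rewrite extP.
rewrite -[X in homalg_post _ X]/(tw f ∘ tw g) hpostM -compA extP compA extP -compA.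
by congr (_ ∘ _); exact: (@fmapM L (op V) (T1 : model L (op V))).
Qed.

Lemma tprod n : is_product (C := op V) (fun i : 'I_n => fmap tfun (lproj i)).
Proof.
move=> Y f.
have [g [gP gU]] := @mfunP L (op V) (T1 : model L (op V)) n (homalg T2 Y)
  (fun i => homalg_post T2 (f i : @hom V _ Y) ∘ uV (co T1 1) T2).
have E (h : hom (coendV (co T1 n) T2) Y) i :
    homalg_post T2 (h ∘ tw (lproj i)) ∘ uV _ T2 =
    (homalg_post T2 h ∘ uV _ T2) ∘ cw T1 (lproj i).
  by rewrite hpostM -compA extP compA.
exists (ext (g : @hom V (co T1 n) (homalg T2 Y))); split=> [i|h hP].
  by apply: ext_un; rewrite [LHS]E extP; exact: gP.
apply: ext_un; rewrite extP; apply: gU => i.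
by rewrite -(hP i); exact: (esym (E h i)).
Qed.

Definition tensorT : M := @Model L (op V) tfun tprod.

Program Definition bT X : iso (homalg tensorT X) (homalg T1 (homalg T2 X)) :=
  @Iso V (homalg tensorT X) (homalg T1 (homalg T2 X))
    (@ModelHom L SET (homalg tensorT X) (homalg T1 (homalg T2 X))
      (fun n (g : hom (coendV (co T1 n) T2) X) => homalg_post T2 g ∘ uV _ T2) _)
    (@ModelHom L SET (homalg T1 (homalg T2 X)) (homalg tensorT X)
      (fun n (g : hom (co T1 n) (homalg T2 X)) => ext g) _) _ _.
Next Obligation.
apply: funext => g /=.
rewrite -[LHS]/(homalg_post T2 (@comp V _ _ _ g (tw w)) ∘ uV _ T2) hpostM -(@compA V) extP.
exact: (@compA V).
Qed.
Next Obligation.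
apply: funext => g; apply: ext_un; rewrite extP.
rewrite -[RHS]/(homalg_post T2 (@comp V _ _ _ (ext g) (tw w)) ∘ uV _ T2) hpostM -(@compA V) extP.
by rewrite (@compA V) extP.
Qed.
Next Obligation.
by apply: model_hom_eq => n; apply: funext => g; apply: ext_un; exact: extP.
Qed.
Next Obligation.
by apply: model_hom_eq => n; apply: funext => g; exact: extP.
Qed.

Lemma bT_nat X Y (f : hom X Y) :
  bT Y ∘ homalg_post tensorT f = homalg_post T1 (homalg_post T2 f) ∘ bT X.
Proof.
apply: model_hom_eq => n; apply: funext => g.
by rewrite -[LHS]/(homalg_post T2 (f ∘ _) ∘ _) hpostM -(@compA V).
Qed.
End Tensor.

Program Definition yfun (n : nat) : functor L SET :=
  @Functor L SET (fun k => @hom L n k) (fun _ _ w f => w ∘ f) _ _.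
Next Obligation. by apply: funext => f; exact: (@compIm L). Qed.
Next Obligation. by apply: funext => h; exact: (esym (@compA L _ _ _ _ g f h)). Qed.

Lemma yprod n k : is_product (C := SET) (fun i : 'I_k => fmap (yfun n) (lproj i)).
Proof.
apply: SET_product => [c|q q' e].
  by have [g [gP _]] := @lprojP L k n c; exists g.
exact: (prod_un (@lprojP L k)).
Qed.
Definition yV n : V := @Model L SET (yfun n) (@yprod n).
Program Definition ymap (m n : nat) (w : @hom L m n) : hom (yV n) (yV m) :=
  @ModelHom L SET (yV n) (yV m) (fun k f => f ∘ w) _.
Next Obligation. by apply: funext => f; exact: (esym (@compA L _ _ _ _ w0 f w)). Qed.

Program Definition ifun : functor L (op V) := @Functor L (op V) yV ymap _ _.
Next Obligation. by apply: model_hom_eq => k; apply: funext => f; exact: (@compmI L). Qed.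
Next Obligation. by apply: model_hom_eq => k; apply: funext => h; exact: (@compA L). Qed.

Lemma y_yoneda n X (h : hom (yV n) X) k (f : @hom L n k) :
  h k f = fmap (X : model L SET) f (h n (idm (n : L))).
Proof.
have := congr1 (@^~ (idm (n : L))) (naturality h f).
by move=> /= <-; congr (h k _); rewrite -[LHS](@compmI L).
Qed.

Program Definition yel n X (x : (X : model L SET) n) : hom (yV n) X :=
  @ModelHom L SET (yV n) X (fun k f => fmap (X : model L SET) f x) _.
Next Obligation.
apply: funext => f; exact: (congr1 (@^~ x) (@fmapM L SET (X : model L SET) _ _ _ w f)).
Qed.

Lemma yel1 n X x : @yel n X x n (idm (n : L)) = x.
Proof. by rewrite /= fmap1. Qed.

Lemma iprod n : is_product (C := op V) (fun i : 'I_n => fmap ifun (lproj i)).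
Proof.
move=> Y f.
have [x xP] := SET_product_ex (@mfunP L SET (Y : model L SET) n)
  (fun i => (f i : model_hom (yV 1) Y) 1 (idm (1 : L))).
exists (yel x); split=> [i|h hP].
  apply: model_hom_eq => k; apply: funext => g.
  rewrite [RHS]y_yoneda -xP.
  exact: (congr1 (@^~ x) (@fmapM L SET (Y : model L SET) _ _ _ g (lproj i))).
apply: model_hom_eq => k; apply: funext => g; rewrite [RHS]y_yoneda.
apply: (congr1 (fmap (Y : model L SET) g)).
apply: (SET_product_un (@mfunP L SET (Y : model L SET) n)) => i.
rewrite xP -(hP i) /= -y_yoneda.
by rewrite -[LHS]/(h 1 (idm (1 : L) ∘ lproj i)) compIm.
Qed.
Definition IT : M := @Model L (op V) ifun iprod.

Program Definition eT X : iso (homalg IT X) X :=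
  @Iso V (homalg IT X) X
    (@ModelHom L SET (homalg IT X) X (fun n (g : model_hom (yV n) X) => g n (idm (n : L))) _)
    (@ModelHom L SET X (homalg IT X) (fun n x => yel x) _) _ _.
Next Obligation.
apply: funext => g /=; rewrite -[LHS]/(g n (idm (n : L) ∘ w)) compIm.
exact: (y_yoneda g w).
Qed.
Next Obligation.
apply: funext => x; apply: model_hom_eq => k; apply: funext => f.
exact: (esym (congr1 (@^~ x) (@fmapM L SET (X : model L SET) _ _ _ f w))).
Qed.
Next Obligation.
apply: model_hom_eq => n; apply: funext => g; apply: model_hom_eq => k.
by apply: funext => f; exact: (esym (y_yoneda g f)).
Qed.
Next Obligation.
by apply: model_hom_eq => n; apply: funext => x; exact: yel1.
Qed.

Lemma eT_nat X Y (f : hom X Y) : eT Y ∘ homalg_post IT f = f ∘ eT X.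
Proof. by apply: model_hom_eq. Qed.

Definition twmon : monoidal M :=
  mon hpost1 hpostM hpre1 hpreM hprepost hpre_inj hyo bT_nat eT_nat.

Lemma tall_wraith_exists : exists M0 : monoidal M, inhabited (tall_wraith M0).
Proof.
exists twmon; constructor.
refine (@TallWraith L twmon bT bT_nat _ _ eT eT_nat _ _ _).
- by move=> S1 T1 T2 X s; rewrite tenmE hpre1 hpost1 compmI.
- by move=> T1 S2 T2 X s; rewrite tenmE hpre1 compIm.
- by move=> T1 T2 T3 X; exact: alE.
- by move=> T X; exact: luE.
- by move=> T X; exact: ruE.
Qed.
End TW.

End TallWraithExistence.

(* Main.v *)
From mathcomp Require Import all_boot.
From mathcomp Require Import boolp.
Require Import Defs.

Set Implicit Arguments.
Unset Strict Implicit.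
Unset Printing Implicit Defensive.

Import TallWraithExistence.
Local Open Scope cat_scope.

(** Hom(F X, A) is the set |A|^X, which underlies the power algebra A^X; so F X
    is a co-algebra Fhat X with Hom(Fhat X, A) = A^X, naturally in X and A.
    Currying A^(X * Y) = (A^Y)^X and A^1 = A are natural in A, so by the Yoneda
    lemma they come from isomorphisms Fhat X ⊙ Fhat Y = Fhat (X * Y) and
    I = Fhat 1.  The coherence axioms, read through Yoneda, become identities
    between currying maps, checked on elements of powers. *)

(** Rebuilding [F] from its two maps changes only the proofs of the functor laws, and these are
    irrelevant. *)
Lemma functor_eta (C D : category) (F : functor C D) map1 mapM :
  @Functor C D (fun A => F A) (fun _ _ f => fmap F f) map1 mapM = F.
Proof.
by case: F map1 mapM => o m p q p' q'; congr Functor; exact: Prop_irrelevance.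
Qed.

(** * Finite copowers of sets *)

Section Copower.
Implicit Types (n : nat) (X Y : Type).

(* At n = 1 the copower must be X itself, not 'I_1 * X, so that the underlying
   algebra of the lifted comodel is F X on the nose. *)
Definition copower n X : Type := match n with 1 => X | _ => ('I_n * X)%type end.

Definition copower_in n X : 'I_n -> X -> copower n X :=
  match n return 'I_n -> X -> copower n X with
  | 1 => fun _ x => x
  | _ => fun i x => (i, x)
  end.

Definition copower_map n X Y (h : X -> Y) : copower n X -> copower n Y :=
  match n return copower n X -> copower n Y with
  | 1 => h
  | _ => fun p => (p.1, h p.2)
  end.

Lemma copower_map_in n X Y (h : X -> Y) i x :
  copower_map h (copower_in i x) = @copower_in n Y i (h x).
Proof. by case: n i => [|[|n]]. Qed.

(** With [copower_ext], this is the universal property of a coproduct of [n] copies of [X]; no later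
    argument splits on [n]. *)
Lemma copower_desc n X Y (f : 'I_n -> X -> Y) :
  exists g : copower n X -> Y, forall i x, g (copower_in i x) = f i x.
Proof.
case: n f => [|[|n]] f; last by exists (fun p => f p.1 p.2).
  by exists (fun p => f p.1 p.2).
by exists (f ord0) => i x; rewrite (ord1 i).
Qed.

Lemma copower_ext n X Y (g h : copower n X -> Y) :
  (forall i x, g (copower_in i x) = h (copower_in i x)) -> g = h.
Proof.
case: n g h => [|[|n]] g h gh; apply: funext.
- by case=> i x; exact: (gh i x).
- by move=> x; exact: (gh ord0 x).
- by case=> i x; exact: (gh i x).
Qed.

Lemma copower_map1 n X : copower_map (fun x : X => x) = (fun p : copower n X => p).
Proof. by apply: copower_ext => i x; rewrite copower_map_in. Qed.

Lemma copower_mapM n X Y Z (g : Y -> Z) (f : X -> Y) :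
  copower_map (fun x => g (f x)) =
  (fun p : copower n X => copower_map g (copower_map f p)).
Proof. by apply: copower_ext => i x; rewrite !copower_map_in. Qed.

End Copower.

(** * Strong monoidality detected on hom-algebras *)

Section StrongMonoidal.
Variables (L : lawvere_theory) (M : monoidal (comodels L (variety L))).
Variable tw : tall_wraith M.
Local Notation V := (variety L).
Local Notation post := homalg_post.
Local Notation pre := homalg_pre.
Implicit Types (A B : V).

(** As [tensorm M f g] factors into one map per argument, the two one-variable naturalities of
    [twcomp] combine. *)
Lemma twcomp_tensorm (S1 T1 S2 T2 : comodels L V) (f : hom S1 T1) (g : hom S2 T2) A :
  twcomp tw S1 S2 A ∘ pre A (tensorm M f g) =
  pre (homalg S2 A) f ∘ (post T1 (pre A g) ∘ twcomp tw T1 T2 A).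
Proof.
have -> : tensorm M f g = tensorm M (idm T1) g ∘ tensorm M f (idm S2).
  by rewrite -tensormM compIm compmI.
by rewrite hpreM compA twcomp_natl -compA twcomp_natr.
Qed.

Lemma twcomp_tensormA (S1 T1 S2 T2 : comodels L V) (f : hom S1 T1) (g : hom S2 T2)
    A B (x : hom B _) :
  twcomp tw S1 S2 A ∘ (pre A (tensorm M f g) ∘ x) =
  pre (homalg S2 A) f ∘ (post T1 (pre A g) ∘ (twcomp tw T1 T2 A ∘ x)).
Proof. by rewrite compA twcomp_tensorm -!compA. Qed.

Variables (C : category) (MC : monoidal C) (T : functor C (comodels L V)).
(** [c] and [u] stand to [T] as [twcomp] and [twid] stand to [M]; the hypotheses on them mirror the
    fields of [tall_wraith], with [c_pre] in the shape of [twcomp_tensorm]. *)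
Variable c : forall X Y A,
  iso (homalg (T (tensor MC X Y)) A) (homalg (T X) (homalg (T Y) A)).
Variable u : forall A, iso (homalg (T (munit MC)) A) A.
Hypothesis c_post : forall X Y A B (f : hom A B),
  c X Y B ∘ post (T (tensor MC X Y)) f = post (T X) (post (T Y) f) ∘ c X Y A.
Hypothesis c_pre : forall X X' Y Y' (f : hom X X') (g : hom Y Y') A,
  c X Y A ∘ pre A (fmap T (tensorm MC f g)) =
  pre (homalg (T Y) A) (fmap T f) ∘ (post (T X') (pre A (fmap T g)) ∘ c X' Y' A).
Hypothesis u_post : forall A B (f : hom A B),
  u B ∘ post (T (munit MC)) f = f ∘ u A.
Hypothesis c_assoc : forall X Y Z A,
  c X Y (homalg (T Z) A) ∘
    (c (tensor MC X Y) Z A ∘ pre A (fmap T (massoc MC X Y Z))) =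
  post (T X) (c Y Z A) ∘ c X (tensor MC Y Z) A.
Hypothesis c_lunit : forall X A,
  u (homalg (T X) A) ∘ (c (munit MC) X A ∘ pre A (fmap T (mlunit MC X))) =
  idm (homalg (T X) A).
Hypothesis c_runit : forall X A,
  post (T X) (u A) ∘ (c X (munit MC) A ∘ pre A (fmap T (mrunit MC X))) =
  idm (homalg (T X) A).

(** Yoneda: [r] followed by the inverse of [l] is natural between hom-algebra functors, hence
    induced by an isomorphism of comodels. *)
Lemma comodel_iso (S S' : comodels L V) (G : V -> V)
    (pg : forall A B, hom A B -> hom (G A) (G B))
    (l : forall A, iso (homalg S A) (G A)) (r : forall A, iso (homalg S' A) (G A)) :
  (forall A B (f : hom A B), l B ∘ post S f = pg A B f ∘ l A) ->
  (forall A B (f : hom A B), r B ∘ post S' f = pg A B f ∘ r A) ->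
  exists i : iso S S', forall A, l A ∘ pre A i = r A.
Proof.
exact: (@yo_iso2 (comodels L V) V (@homalg L V) (@homalg_post L V)
  (@homalg_pre L V) (@hpre1 L) (@hpreM L) (@hpre_inj L) (@hyo L)).
Qed.

(** Both comodels corepresent [Hom(T X, Hom(T Y, -))], one through [twcomp], the other through
    [c]. *)
Lemma tensor_iso_ex X Y : exists s : iso (tensor M (T X) (T Y)) (T (tensor MC X Y)),
  forall A, twcomp tw (T X) (T Y) A ∘ pre A s = c X Y A.
Proof.
exact: (comodel_iso (pg := fun A B f => post (T X) (post (T Y) f))
  (@twcomp_nat _ _ tw (T X) (T Y)) (@c_post X Y)).
Qed.

Definition tensor_iso X Y := sval (cid (tensor_iso_ex X Y)).

Lemma tensor_isoE X Y A :
  twcomp tw (T X) (T Y) A ∘ pre A (tensor_iso X Y) = c X Y A.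
Proof. exact: (svalP (cid (tensor_iso_ex X Y))). Qed.

Lemma tensor_isoEA X Y A B (x : hom B _) :
  twcomp tw (T X) (T Y) A ∘ (pre A (tensor_iso X Y) ∘ x) = c X Y A ∘ x.
Proof. by rewrite compA tensor_isoE. Qed.

(** Both comodels corepresent the identity functor of [V]. *)
Lemma unit_iso_ex : exists s : iso (munit M) (T (munit MC)),
  forall A, twid tw A ∘ pre A s = u A.
Proof. exact: (comodel_iso (pg := fun A B f => f) (@twid_nat _ _ tw) u_post). Qed.

Definition unit_iso := sval (cid unit_iso_ex).

Lemma unit_isoE A : twid tw A ∘ pre A unit_iso = u A.
Proof. exact: (svalP (cid unit_iso_ex)). Qed.

Lemma tensor_iso_nat X X' Y Y' (f : hom X X') (g : hom Y Y') :
  tensor_iso X' Y' ∘ tensorm M (fmap T f) (fmap T g) =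
  fmap T (tensorm MC f g) ∘ tensor_iso X Y.
Proof.
(* A comodel map is determined by its action on hom-algebras, and there the invertible [twcomp] may
   be cancelled; this brings [tensor_isoE] into play. *)
apply: hpre_inj => A; apply: (can_l (i := twcomp tw _ _ _)).
by rewrite !hpreM twcomp_tensormA tensor_isoE tensor_isoEA c_pre.
Qed.

Lemma tensor_iso_assoc X Y Z :
  fmap T (massoc MC X Y Z) ∘ tensor_iso (tensor MC X Y) Z
    ∘ tensorm M (tensor_iso X Y) (idm (T Z)) =
  tensor_iso X (tensor MC Y Z) ∘ tensorm M (idm (T X)) (tensor_iso Y Z)
    ∘ massoc M (T X) (T Y) (T Z).
Proof.
apply: hpre_inj => A; apply: (can_l (i := twcomp tw _ _ _)).
(* With two copies of [twcomp] to cancel, both sides act into the triple hom-algebra; [c_assoc] and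
   [twassoc] bring each to [post (T X) (c Y Z A) ∘ c X (tensor MC Y Z) A]. *)
apply: (can_l (i := twcomp tw _ _ _)); rewrite !hpreM.
rewrite twcomp_tensormA hpre1 hpost1 compIm tensor_isoEA tensor_isoEA c_assoc.
rewrite [RHS]compA [RHS]compA twassoc -[RHS]compA.
by rewrite twcomp_tensormA hpre1 compIm tensor_isoE compA -hpostM tensor_isoE.
Qed.

Lemma tensor_iso_lunit X :
  fmap T (mlunit MC X) ∘ tensor_iso (munit MC) X ∘ tensorm M unit_iso (idm (T X)) =
  mlunit M (T X).
Proof.
apply: hpre_inj => A; apply: (can_l (i := twcomp tw _ _ _)).
(* Both sides become the identity, by [twlunit] on the right and [c_lunit] on the left. *)
apply: (can_l (i := twid tw _)); rewrite [RHS]compA twlunit !hpreM.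
rewrite twcomp_tensormA hpre1 hpost1 compIm tensor_isoEA.
by rewrite compA unit_isoE c_lunit.
Qed.

Lemma tensor_iso_runit X :
  fmap T (mrunit MC X) ∘ tensor_iso X (munit MC) ∘ tensorm M (idm (T X)) unit_iso =
  mrunit M (T X).
Proof.
apply: hpre_inj => A; apply: (can_l (i := twcomp tw _ _ _)).
(* Here [twid] sits inside [homalg (T X)], so the isomorphism to cancel is its image under
   [post]. *)
apply: (can_l (i := postiso (@hpost1 L) (@hpostM L) (T X) (twid tw A))).
rewrite -[fwd (postiso _ _ _ _)]/(post (T X) (twid tw A)).
rewrite [RHS]compA twrunit !hpreM twcomp_tensormA hpre1 compIm tensor_isoEA.
by rewrite compA -hpostM unit_isoE c_runit.
Qed.

(* A functor is strong monoidal as soon as its hom-algebras Hom(T X, -) turn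
   tensors into composition coherently. *)
Definition strong_monoidal_of_homalg : strong_monoidal MC M T :=
  StrongMonoidal tensor_iso_nat tensor_iso_assoc tensor_iso_lunit tensor_iso_runit.

End StrongMonoidal.

(** * Free algebras on copowers, and the co-algebra structure they carry *)

Section FreeComodel.
Variables (L : lawvere_theory) (F : functor SET (variety L)).
Variable adj : adjunction F (underlying L).
Local Notation V := (variety L).
Implicit Types (X Y : Type) (A B : V).

Definition ev A B (f : hom A B) n : (A : model L SET) n -> (B : model L SET) n :=
  (f : model_hom (A : model L SET) B) n.

Lemma evN A B (f : hom A B) m n (w : @hom L m n) a :
  ev f (fmap (A : model L SET) w a) = fmap (B : model L SET) w (ev f a).
Proof. exact: (congr1 (@^~ a) (naturality f w)). Qed.

(** The unit of the adjunction. *)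
Definition gen X : X -> (F X : model L SET) 1 := transpose adj (idm (F X)).

Lemma gen_transpose X A (g : hom (F X) A) x : ev g (gen x) = transpose adj g x.
Proof. by rewrite -[in RHS](compmI g) transpose_natr. Qed.

Lemma gen_nat X Y (h : X -> Y) x :
  ev (fmap F (h : @hom SET X Y)) (gen x) = gen (h x).
Proof.
rewrite gen_transpose -[fmap F _]compIm.
by rewrite (transpose_natl adj (h : @hom SET X Y)).
Qed.

Lemma free_desc X A (f : X -> (A : model L SET) 1) :
  exists g : hom (F X) A, forall x, ev g (gen x) = f x.
Proof.
exists (untranspose adj (f : @hom SET X (underlying L A))) => x.
by rewrite gen_transpose untransposeK.
Qed.

Lemma model_ext A n (a b : (A : model L SET) n) :
  (forall i : 'I_n, fmap (A : model L SET) (lproj i) a =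
     fmap (A : model L SET) (lproj i) b) -> a = b.
Proof. exact: (SET_product_un (@mfunP L SET (A : model L SET) n)). Qed.

Lemma tuple_gen_ex n X : exists u : X -> (F (copower n X) : model L SET) n,
  forall i x, fmap (F (copower n X) : model L SET) (lproj i) (u x) =
    gen (copower_in i x).
Proof.
have ex x := cid (SET_product_ex (@mfunP L SET (F (copower n X) : model L SET) n)
  (fun i => gen (copower_in i x))).
by exists (fun x => sval (ex x)) => i x; exact: (svalP (ex x)).
Qed.

(* The universal element exhibiting F (copower n X) as corepresenting
   A |-> (X -> A n). *)
Definition tuple_gen n X := sval (cid (tuple_gen_ex n X)).

Lemma tuple_genE n X i x :
  fmap (F (copower n X) : model L SET) (lproj i) (tuple_gen n x) =
  gen (copower_in i x).
Proof. exact: (svalP (cid (tuple_gen_ex n X))). Qed.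

(** A homomorphism out of a free algebra is fixed by its values on generators, and each generator of
    [F (copower n X)] is a coordinate of some [tuple_gen n x]. *)
Lemma tuple_ext n X A (f g : hom (F (copower n X)) A) :
  (forall x, ev f (tuple_gen n x) = ev g (tuple_gen n x)) -> f = g.
Proof.
move=> fg; apply: (can_inj (@transposeK _ _ _ _ adj (copower n X) A)).
apply: copower_ext => i x; rewrite -!gen_transpose -tuple_genE.
by rewrite !evN fg.
Qed.

Lemma tuple_desc_ex n X A (f : X -> (A : model L SET) n) :
  exists g : hom (F (copower n X)) A, forall x, ev g (tuple_gen n x) = f x.
Proof.
have [h hP] := copower_desc (fun (i : 'I_n) x => fmap (A : model L SET) (lproj i) (f x)).
have [g gP] := free_desc h.
exists g => x; apply: model_ext => i.
by rewrite -evN tuple_genE gP hP.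
Qed.

Definition tuple_desc n X A (f : X -> (A : model L SET) n) :
  hom (F (copower n X)) A := sval (cid (tuple_desc_ex f)).

Lemma tuple_descE n X A (f : X -> (A : model L SET) n) x :
  ev (tuple_desc f) (tuple_gen n x) = f x.
Proof. exact: (svalP (cid (tuple_desc_ex f))). Qed.

Lemma tuple_gen_nat n X Y (h : X -> Y) x :
  ev (fmap F (copower_map (n := n) h : @hom SET _ _)) (tuple_gen n x) =
  tuple_gen n (h x).
Proof.
apply: model_ext => i.
by rewrite -evN !tuple_genE gen_nat copower_map_in.
Qed.

(** By Yoneda, the action of [w] on families [X -> A m], natural in [A], is precomposition with the
    map found by applying it to the universal family. *)
Definition free_op X (m n : nat) (w : @hom L m n) :
    hom (F (copower n X)) (F (copower m X)) :=
  tuple_desc (fun x => fmap (F (copower m X) : model L SET) w (tuple_gen m x)).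

Lemma free_opE X (m n : nat) (w : @hom L m n) x :
  ev (free_op X w) (tuple_gen n x) =
  fmap (F (copower m X) : model L SET) w (tuple_gen m x).
Proof. exact: tuple_descE. Qed.

Program Definition free_functor X : functor L (op V) :=
  @Functor L (op V) (fun n => F (copower n X)) (@free_op X) _ _.
Next Obligation. by apply: tuple_ext => x; rewrite free_opE fmap1. Qed.
Next Obligation.
apply: tuple_ext => x; rewrite free_opE.
rewrite -[RHS]/(ev (free_op X f) (ev (free_op X g) (tuple_gen _ x))).
by rewrite free_opE evN free_opE fmapM.
Qed.

(** A cotuple of [f] amounts to a family of [n]-tuples in [A], which exists and is unique since
    [A n] is the [n]-th power of [A 1]. *)
Lemma free_coproduct X n :
  is_product (C := op V) (fun i : 'I_n => fmap (free_functor X) (lproj i)).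
Proof.
move=> A f.
(* Values are read at [tuple_gen 1 x] instead of [gen x], because [lproj] at [n = 1] need not be the
   identity. *)
have ex x := cid (SET_product_ex (@mfunP L SET (A : model L SET) n)
  (fun i => ev (f i : @hom V (F X) A) (tuple_gen 1 x))).
have E (h : hom (F (copower n X)) A) i x :
    ev (h ∘ free_op X (lproj i)) (tuple_gen 1 x) =
    fmap (A : model L SET) (lproj i) (ev h (tuple_gen n x)).
  rewrite -[LHS]/(ev h (ev (free_op X (lproj i)) (tuple_gen 1 x))).
  by rewrite free_opE evN.
exists (tuple_desc (fun x => sval (ex x))); split=> [i|h hP].
  apply: (@tuple_ext 1 X A) => x; rewrite [LHS]E tuple_descE.
  exact: (svalP (ex x)).
apply: tuple_ext => x; rewrite tuple_descE; apply: model_ext => i.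
rewrite (svalP (ex x)) -E.
exact: (congr1 (fun k : hom (F X) A => ev k (tuple_gen 1 x)) (esym (hP i))).
Qed.

Definition free_comodel X : comodels L V :=
  @Model L (op V) (free_functor X) (@free_coproduct X).

Program Definition free_comodel_map X Y (h : X -> Y) :
    @hom (comodels L V) (free_comodel X) (free_comodel Y) :=
  @ModelHom L (op V) (free_comodel Y) (free_comodel X)
    (fun n => fmap F (copower_map (n := n) h : @hom SET _ _)) _.
Next Obligation.
apply: tuple_ext => x.
rewrite -[LHS]/(ev (free_op Y w) (ev (fmap F _) (tuple_gen _ x))).
rewrite -[RHS]/(ev (fmap F _) (ev (free_op X w) (tuple_gen _ x))).
by rewrite tuple_gen_nat !free_opE evN tuple_gen_nat.
Qed.

Program Definition free_comodel_functor : functor SET (comodels L V) :=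
  @Functor SET (comodels L V) free_comodel free_comodel_map _ _.
Next Obligation.
apply: (@model_hom_eq L (op V)) => n /=.
by rewrite copower_map1 fmap1.
Qed.
Next Obligation.
apply: (@model_hom_eq L (op V)) => n /=.
by rewrite (copower_mapM n g f) fmapM.
Qed.

(** At [n = 1], [copower n X] reduces to [X] and [copower_map h] to [h], so the composite agrees
    with [F] by conversion up to the proofs of the laws. *)
Lemma free_comodel_functor_lift : fcomp (coforget L V) free_comodel_functor = F.
Proof. exact: functor_eta. Qed.

(* A homomorphism g : F (copower n X) -> A, as a family in the n-th power of A
   indexed by X. *)
Definition at_gen n X A (g : hom (F (copower n X)) A) (x : X) :
  (A : model L SET) n := ev g (tuple_gen n x).

(** Pointwise action on families is what identifies [homalg (free_comodel X) A] with the power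
    algebra of [A] indexed by [X]. *)
Lemma at_gen_op X A (m n : nat) (w : @hom L m n) (g : hom (F (copower m X)) A) x :
  at_gen (g ∘ free_op X w) x = fmap (A : model L SET) w (at_gen g x).
Proof.
rewrite -[LHS]/(ev g (ev (free_op X w) (tuple_gen n x))).
by rewrite free_opE evN.
Qed.

Lemma at_gen_pre n X Y A (h : X -> Y) (g : hom (F (copower n Y)) A) x :
  at_gen (g ∘ fmap F (copower_map (n := n) h : @hom SET _ _)) x = at_gen g (h x).
Proof.
rewrite -[LHS]/(ev g (ev (fmap F (copower_map h : @hom SET _ _)) (tuple_gen n x))).
by rewrite tuple_gen_nat.
Qed.

(** An element of [homalg (free_comodel Y) A] at arity [n] is itself a homomorphism out of
    [F (copower n Y)], so two nested [tuple_desc] curry a family indexed by [X * Y]. *)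
Definition curry X Y A n (g : hom (F (copower n (X * Y))) A) :
    hom (F (copower n X)) (homalg (free_comodel Y) A) :=
  tuple_desc (A := homalg (free_comodel Y) A)
    (fun x => tuple_desc (fun y => at_gen g (x, y))).

Definition uncurry X Y A n (h : hom (F (copower n X)) (homalg (free_comodel Y) A)) :
    hom (F (copower n (X * Y))) A :=
  tuple_desc (fun p => at_gen (A := A) (at_gen h p.1) p.2).

Lemma at_curry X Y A n (g : hom (F (copower n (X * Y))) A) x y :
  at_gen (A := A) (at_gen (curry g) x) y = at_gen g (x, y).
Proof. by rewrite {2}/at_gen tuple_descE [LHS]tuple_descE. Qed.

Lemma at_uncurry X Y A n (h : hom (F (copower n X)) (homalg (free_comodel Y) A)) p :
  at_gen (uncurry h) p = at_gen (A := A) (at_gen h p.1) p.2.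
Proof. exact: tuple_descE. Qed.

Lemma at_gen2_ext X Y A n (g h : hom (F (copower n X)) (homalg (free_comodel Y) A)) :
  (forall x y, at_gen (A := A) (at_gen g x) y = at_gen (A := A) (at_gen h x) y) ->
  g = h.
Proof.
move=> gh; apply: tuple_ext => x.
apply: (@tuple_ext n Y A) => y; exact: gh.
Qed.

Lemma at_gen2_op X Y A (m n : nat) (w : @hom L m n)
    (h : hom (F (copower m X)) (homalg (free_comodel Y) A)) x y :
  at_gen (A := A) (at_gen (h ∘ free_op X w) x) y =
  fmap (A : model L SET) w (at_gen (A := A) (at_gen h x) y).
Proof. by rewrite at_gen_op [LHS]at_gen_op. Qed.

(** Operations are pointwise on both sides, so currying respects them. *)
Program Definition curry_iso X Y A :
    iso (homalg (free_comodel (X * Y)) A)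
      (homalg (free_comodel X) (homalg (free_comodel Y) A)) :=
  @Iso V _ _
    (@ModelHom L SET (homalg (free_comodel (X * Y)) A)
      (homalg (free_comodel X) (homalg (free_comodel Y) A)) (@curry X Y A) _)
    (@ModelHom L SET (homalg (free_comodel X) (homalg (free_comodel Y) A))
      (homalg (free_comodel (X * Y)) A) (@uncurry X Y A) _) _ _.
Next Obligation.
apply: funext => g; apply: at_gen2_ext => x y.
by rewrite [RHS]at_gen2_op !at_curry [LHS]at_gen_op.
Qed.
Next Obligation.
apply: funext => h; apply: tuple_ext => p.
by rewrite [RHS]at_gen_op [LHS]at_uncurry [LHS]at_gen2_op at_uncurry.
Qed.
Next Obligation.
apply: model_hom_eq => n; apply: funext => g; apply: tuple_ext => -[x y].
by rewrite [LHS]at_uncurry [LHS]at_curry.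
Qed.
Next Obligation.
apply: model_hom_eq => n; apply: funext => g; apply: at_gen2_ext => x y.
by rewrite [LHS]at_curry [LHS]at_uncurry.
Qed.

Program Definition unit_eval A : iso (homalg (free_comodel unit) A) A :=
  @Iso V _ _
    (@ModelHom L SET (homalg (free_comodel unit) A) A
      (fun n (g : hom (F (copower n unit)) A) => at_gen g tt) _)
    (@ModelHom L SET A (homalg (free_comodel unit) A)
      (fun n a => tuple_desc (fun _ => a)) _) _ _.
Next Obligation. by apply: funext => g; exact: at_gen_op. Qed.
Next Obligation.
apply: funext => a; apply: tuple_ext => x.
by rewrite tuple_descE [RHS]at_gen_op [in RHS]/at_gen tuple_descE.
Qed.
Next Obligation.
apply: model_hom_eq => n; apply: funext => g; apply: tuple_ext => -[].
exact: tuple_descE.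
Qed.
Next Obligation.
apply: model_hom_eq => n; apply: funext => a; exact: tuple_descE.
Qed.

(** * Naturality and coherence of currying *)

Local Notation T := free_comodel_functor.
Local Notation post := homalg_post.
Local Notation pre := homalg_pre.

Lemma curry_post X Y A B (f : hom A B) :
  curry_iso X Y B ∘ post (T (X * Y)%type) f =
  post (T X) (post (T Y) f) ∘ curry_iso X Y A.
Proof.
apply: model_hom_eq => n; apply: funext => g; apply: at_gen2_ext => x y.
rewrite [LHS]at_curry.
rewrite -[LHS]/(ev f (at_gen (n := n) g (x, y))).
by rewrite -at_curry.
Qed.

(** Both sides read [h] at [(f x, g y)]. *)
Lemma curry_pre X X' Y Y' (f : @hom SET X X') (g : @hom SET Y Y') A :
  curry_iso X Y A ∘ pre A (fmap T (tensorm set_cartesian f g)) =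
  pre (homalg (T Y) A) (fmap T f) ∘ (post (T X') (pre A (fmap T g)) ∘ curry_iso X' Y' A).
Proof.
apply: model_hom_eq => n; apply: funext => h; apply: at_gen2_ext => x y.
rewrite [LHS]at_curry [LHS]at_gen_pre -[LHS]at_curry.
(* Reindexing along [f] concerns the outer family, that along [g] the inner one; the outer equation
   is stated apart and then evaluated at [y]. *)
have e := at_gen_pre f (pre A (fmap T g) ∘ curry h) x.
rewrite -(at_gen_pre g (at_gen (curry h) (f x))).
exact: (congr1 (fun z : hom (F (copower n Y)) A => at_gen z y) (esym e)).
Qed.

Lemma unit_eval_post A B (f : hom A B) :
  unit_eval B ∘ post (T unit) f = f ∘ unit_eval A.
Proof. exact: model_hom_eq. Qed.

(** Both sides read [h] at [(x, (y, z))]. *)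
Lemma curry_assoc X Y Z A :
  curry_iso X Y (homalg (T Z) A) ∘
    (curry_iso (X * Y) Z A ∘ pre A (fmap T (massoc set_cartesian X Y Z))) =
  post (T X) (curry_iso Y Z A) ∘ curry_iso X (Y * Z) A.
Proof.
apply: model_hom_eq => n; apply: funext => h; apply: at_gen2_ext => x y.
apply: (@tuple_ext n Z A) => z.
rewrite at_curry [LHS]at_curry [LHS]at_gen_pre.
(* By conversion, [post] curries each value of the outer family. *)
rewrite -[RHS]/(at_gen (A := A)
  (at_gen (curry (at_gen (n := n) (curry (Y := Y * Z) h) x)) y) z).
by rewrite at_curry [RHS]at_curry.
Qed.

(** Evaluation at [tt] leaves [h] precomposed with the left unitor and read at [(tt, x)], that is,
    [h] at [x]. *)
Lemma curry_lunit X A :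
  unit_eval (homalg (T X) A) ∘
    (curry_iso unit X A ∘ pre A (fmap T (mlunit set_cartesian X))) =
  idm (homalg (T X) A).
Proof.
apply: model_hom_eq => n; apply: funext => h; apply: tuple_ext => x.
by rewrite [LHS]at_curry [LHS]at_gen_pre.
Qed.

Lemma curry_runit X A :
  post (T X) (unit_eval A) ∘
    (curry_iso X unit A ∘ pre A (fmap T (mrunit set_cartesian X))) =
  idm (homalg (T X) A).
Proof.
apply: model_hom_eq => n; apply: funext => h; apply: tuple_ext => x.
by rewrite [LHS]at_curry [LHS]at_gen_pre.
Qed.

End FreeComodel.

Theorem theorem1p2 (L : lawvere_theory) (F : functor SET (variety L))
    (adj : adjunction F (underlying L))
    (M : monoidal (comodels L (variety L))) (tw : tall_wraith M) :
  exists (Fhat : functor SET (comodels L (variety L)))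
         (_ : strong_monoidal set_cartesian M Fhat),
    fcomp (coforget L (variety L)) Fhat = F.
Proof.
exists (free_comodel_functor adj).
exists (strong_monoidal_of_homalg (MC := set_cartesian) (T := free_comodel_functor adj)
  (c := curry_iso adj) (u := unit_eval adj) tw (curry_post adj) (curry_pre adj)
  (unit_eval_post adj) (curry_assoc adj) (curry_lunit adj) (curry_runit adj)).
exact: free_comodel_functor_lift.
Qed.
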